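(* Assume that $X$ and $X^{(0)}$ are $[0,\infty]$-valued product measurable processes satisfying $\mathbb{E}[(X_t^{(0)})^p]\le\mathbb{E}[X_t^p]$, $$\mathbb{E}\big[X_t^p\big]^{\frac1p}\le v(t)+\bigg(\int_{[0,t]}l(t,s)^\beta\mathbb{E}\big[(X_s^{(0)})^p\big]^{\frac\beta p}\,\mu(\mathrm{d}s)\bigg)^{\frac1\beta}\qquad(1)$$ and $\lim_{n\uparrow\infty}\int_{[0,t]}l_{\mu,n,\beta,p}(t,s)\mathbb{E}[(X_s^{(0)})^p]\,\mu(\mathrm{d}s)=0$ for any $t\in J$. Then $$\bigg(\int_{[0,t]}\mathbb{E}\big[X_s^p\big]\,\mu(\mathrm{d}s)\bigg)^{\frac1p}\le\bigg(\int_{[0,t]}v(s)^p\,\mu(\mathrm{d}s)\bigg)^{\frac1p}+\sum_{n=1}^\infty\bigg(\int_{[0,t]}l_{\mu,n,\beta,p}(t,s)v(s)^p\,\mu(\mathrm{d}s)\bigg)^{\frac1p}$$ for every $t\in J$, and equality holds if $\beta=p=1$ and the inequality symbol in (1) is replaced by an equal sign.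
   Context: $(\Omega,\mathcal{F},\mathbb{P})$ is a probability space, $I$ is a non-degenerate interval in $[0,\infty)$ with $0\in I$, $\mu$ is a $\sigma$-finite Borel measure on $I$ and $J$ is a set in $I$ of full $\mu$-measure. $p\ge1$ and $\beta\in[1,p]$. $Y$ is a $[0,\infty]$-valued product measurable process. A non-negative kernel on $I$ is a $[0,\infty]$-valued measurable function on $\{(t,s)\in I\times I:s\le t\}$; $k$ and $l$ are non-negative kernels on $I$, and $v(t):=\mathbb{E}[Y_t^p]^{1/p}+(\int_{[0,t]}k(t,s)^\beta\,\mu(\mathrm{d}s))^{1/\beta}$ for $t\in I$. The iterated kernels of a non-negative kernel $k$ relative to $\mu$ are $\mathrm{R}_{k,\mu,1}:=k$, $\mathrm{R}_{k,\mu,n+1}(t,s):=\int_{[s,t]}k(t,\tilde s)\mathrm{R}_{k,\mu,n}(\tilde s,s)\,\mu(\mathrm{d}\tilde s)$. For $n\in\mathbb{N}$, $$l_{\mu,n,\beta,p}(t,s):=\int_{[s,t]}\Big(\int_{[0,\tilde s]}\mathrm{R}_{l^\beta,\mu,n}(\tilde s,r)\,\mu(\mathrm{d}r)\Big)^{\frac p\beta-1}\mathrm{R}_{l^\beta,\mu,n}(\tilde s,s)\,\mu(\mathrm{d}\tilde s)\quad\text{if }\beta<p,$$ and $l_{\mu,n,\beta,p}(t,s):=\int_{[s,t]}\mathrm{R}_{l^\beta,\mu,n}(\tilde s,s)\,\mu(\mathrm{d}\tilde s)$ if $\beta=p$.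
   Formalization: The equality claim is proved under the extra assumption E[(X_t^(0))^p] = E[X_t^p] for t in J; without it the claim fails (e.g. X^(0)=0, X=Y=1, l=1, k=0, Lebesgue measure on [0,1], β=p=1). *)

(* Defs.v *)
From HB Require Import structures.
From mathcomp Require Import all_boot all_order all_algebra.
From mathcomp Require Import all_classical all_reals all_analysis.
From mathcomp Require Import measurable_realfun.

Set Implicit Arguments.
Unset Strict Implicit.
Unset Printing Implicit Defensive.

Import Order.TTheory GRing.Theory Num.Theory.
Import numFieldNormedType.Exports.

Local Open Scope classical_set_scope.
Local Open Scope ring_scope.
Local Open Scope ereal_scope.

(* Processes and kernels on an interval I are represented by functions that are
   total in the time variables; only their values at times in I (for kernels:
   at pairs in [triangle I]) are constrained by the predicates below. *)

Definition time_interval (R : realType) (I : set R) : Prop :=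
  [/\ is_interval I, I `<=` [set x | (0 <= x)%R], I 0%R
    & exists2 x, I x & (0 < x)%R].

(* Borel measures on I are represented by Borel measures on R without mass
   outside of I. *)
Definition carried_by (R : realType)
    (mu : set (measurableTypeR R) -> \bar R) (I : set R) : Prop :=
  mu (~` I) = 0.

(* J itself is not required to be Borel. *)
Definition full_measure (R : realType)
    (mu : set (measurableTypeR R) -> \bar R) (I J : set R) : Prop :=
  J `<=` I /\ mu.-negligible (I `\` J).

Definition nonneg_process d (Omega : measurableType d) (R : realType)
    (I : set R) (X : R -> Omega -> \bar R) : Prop :=
  measurable_fun (I `*` setT)
    (fun tw : measurableTypeR R * Omega => X tw.1 tw.2) /\
  (forall t w, I t -> 0 <= X t w).

Definition triangle (R : realType) (I : set R) :
    set (measurableTypeR R * measurableTypeR R)%type :=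
  [set ts | [/\ I ts.1, I ts.2 & (ts.2 <= ts.1)%R]].

Definition nonneg_kernel (R : realType) (I : set R) (k : R -> R -> \bar R)
    : Prop :=
  measurable_fun (triangle I)
    (fun ts : measurableTypeR R * measurableTypeR R => k ts.1 ts.2) /\
  (forall t s, triangle I (t, s) -> 0 <= k t s).

(* The library's expectation is restricted to real-valued random variables,
   hence the integral of the [0, +oo]-valued p-th power. *)
Definition moment d (Omega : measurableType d) (R : realType)
    (P : probability Omega R) (p : R) (X : R -> Omega -> \bar R) (t : R)
    : \bar R :=
  \int[P]_w (X t w `^ p).

Section kernels.
Context (R : realType).
Variable mu : set (measurableTypeR R) -> \bar R.

(* The index starts at 1; the value at index 0 is a dummy. *)
Fixpoint iterated_kernel (k : R -> R -> \bar R) (n : nat) (t s : R) : \bar R :=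
  match n with
  | 0%N => 0
  | m.+1 =>
      match m with
      | 0%N => k t s
      | _.+1 => \int[mu]_(x in `[s, t]) (k t x * iterated_kernel k m x s)
      end
  end.

(* The kernel l_{mu, n, beta, p}, for 1 <= n. The convention 0 * +oo = 0 is in
   force. *)
Definition power_kernel (l : R -> R -> \bar R) (n : nat) (beta p t s : R)
    : \bar R :=
  let Rn := iterated_kernel (fun t' s' => l t' s' `^ beta) n in
  if (beta < p)%R then
    \int[mu]_(x in `[s, t])
      ((\int[mu]_(r in `[0%R, x]) Rn x r) `^ (p / beta - 1) * Rn x s)
  else \int[mu]_(x in `[s, t]) Rn x s.

End kernels.

Definition bound_v d (Omega : measurableType d) (R : realType)
    (P : probability Omega R) (mu : set (measurableTypeR R) -> \bar R)
    (Y : R -> Omega -> \bar R) (k : R -> R -> \bar R) (beta p t : R)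
    : \bar R :=
  moment P p Y t `^ p^-1 +
  (\int[mu]_(s in `[0%R, t]) (k t s `^ beta)) `^ beta^-1.

(* Main.v *)
Require Import Defs.
From HB Require Import structures.
From mathcomp Require Import all_boot all_order all_algebra.
From mathcomp Require Import all_classical all_reals all_analysis.
From mathcomp Require Import measurable_realfun.

Set Implicit Arguments.
Unset Strict Implicit.
Unset Printing Implicit Defensive.

Import Order.TTheory GRing.Theory Num.Theory.
Import numFieldNormedType.Exports.

Local Open Scope classical_set_scope.
Local Open Scope ring_scope.
Local Open Scope ereal_scope.

(* Put T f (t) = (int_[0,t] l(t,s)^beta f(s)^beta mu(ds))^(1/beta). Minkowski's
   inequality makes T subadditive, so iterating x0 <= x <= v + T x0 for
   x = E[X^p]^(1/p) and x0 = E[X0^p]^(1/p) gives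
   T^n x0 <= T^n v + T^(n+1) x0, and by Tonelli T^n f is given by the iterated
   kernel of l^beta. Telescoping these bounds in L^p([0,t], mu) leaves the terms
   |T^n v|_p and a remainder |T^n x0|_p; Jensen's inequality with weight
   R_n(x, .), followed by Tonelli, bounds |T^n f|_p^p by the integral of
   l_{mu,n,beta,p}(t, .) f^p, so the remainder vanishes in the limit. For
   beta = p = 1 the operator T is linear and the same telescoping gives the
   reverse inequality. All functions are extended by 0 outside of I, so that the
   integrals over [0,t] and [s,t] become integrals over the whole line. *)

(** * Powers of extended reals *)

Lemma measurable_fun_poweR d (T : measurableType d) (R : realType)
    (D : set T) (f : T -> \bar R) (r : R) :
  measurable_fun D f -> measurable_fun D (fun x => f x `^ r).
Proof. exact: (measurableT_comp (measurable_poweR r)). Qed.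

Lemma le_poweR (R : realType) (x y : \bar R) (r : R) : (0 <= r)%R ->
  0 <= x -> x <= y -> x `^ r <= y `^ r.
Proof.
move=> r0 x0 xy; apply: gt0_ler_poweR => //; rewrite in_itv/= ?leey ?andbT//.
exact: le_trans xy.
Qed.

(** * Integral inequalities for [0,+oo]-valued functions *)

Section ereal_integral_inequalities.
Context d (T : measurableType d) (R : realType).
Variable mu : {measure set T -> \bar R}.
Implicit Types (f g w h : T -> \bar R) (p q : R).

(** Allows [f] to be replaced by the real-valued [fine \o f], to which the inequalities for real
    functions apply. *)
Lemma integral_poweR_lty_ae_fin f p : measurable_fun setT f ->
  (forall x, 0 <= f x) -> (0 < p)%R -> \int[mu]_x (f x `^ p) < +oo ->
  {ae mu, forall x, f x = (fine (f x))%:E}.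
Proof.
move=> mf f0 p0 fp.
have : mu.-integrable setT (fun x => f x `^ p).
  apply/integrableP; split; first exact: measurable_fun_poweR.
  by under eq_integral do rewrite gee0_abs ?poweR_ge0//.
move=> /(integrable_ae measurableT); apply: filterS => x /(_ Logic.I).
rewrite ge0_fin_numE ?poweR_ge0// => /lty_poweRy; rewrite gt_eqF// => /(_ isT).
by rewrite -ge0_fin_numE// => /fineK.
Qed.

Lemma integral_poweR_eq0_ae f p : measurable_fun setT f ->
  (forall x, 0 <= f x) -> \int[mu]_x (f x `^ p) = 0 ->
  {ae mu, forall x, f x = 0}.
Proof.
move=> mf f0 fp.
have : \int[mu]_x `|f x `^ p| = 0.
  by under eq_integral do rewrite gee0_abs ?poweR_ge0//.
have := @measurable_fun_poweR _ _ _ setT f p mf.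
move=> mfp /(ae_eq_integral_abs mu measurableT mfp).
by apply: filterS => x /(_ Logic.I)/poweR_eq0_eq0; exact.
Qed.

Lemma integral_poweR_Lnorm f (h : T -> R) p : measurable_fun setT f ->
  measurable_fun setT h -> (forall x, 0 <= f x) ->
  {ae mu, forall x, f x = (h x)%:E} ->
  (\int[mu]_x (f x `^ p)) `^ p^-1 = Lnorm mu p%:E (EFin \o h).
Proof.
move=> mf mh f0 fh; rewrite unlock; congr (_ `^ _).
apply: ge0_ae_eq_integral => //.
- exact: measurable_fun_poweR.
- by apply: measurable_fun_poweR; do 2 apply: measurableT_comp => //.
- by move=> x _; exact: poweR_ge0.
- by move=> x _; exact: poweR_ge0.
- apply: filterS fh => x fx _.
  have -> : `|(EFin \o h) x| = `|f x| by rewrite fx.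
  by rewrite gee0_abs.
Qed.

(** An infinite integral on the right makes the bound trivial. Otherwise both functions are finite
    almost everywhere, and Minkowski's inequality for real functions applies. *)
Lemma minkowski_ge0 f g p : measurable_fun setT f -> measurable_fun setT g ->
  (forall x, 0 <= f x) -> (forall x, 0 <= g x) -> (1 <= p)%R ->
  (\int[mu]_x ((f x + g x) `^ p)) `^ p^-1 <=
  (\int[mu]_x (f x `^ p)) `^ p^-1 + (\int[mu]_x (g x `^ p)) `^ p^-1.
Proof.
move=> mf mg f0 g0 p1.
have p0 : (0 < p)%R by exact: lt_le_trans p1.
have i0 u : 0 <= \int[mu]_x (u x `^ p).
  by apply: integral_ge0 => x _; exact: poweR_ge0.
have [foo|fNoo] := eqVneq (\int[mu]_x (f x `^ p)) +oo.
  by rewrite foo poweRyr ?invr_eq0 ?gt_eqF// addye ?leey// gt_eqF//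
    (lt_le_trans _ (poweR_ge0 _ _)).
have [goo|gNoo] := eqVneq (\int[mu]_x (g x `^ p)) +oo.
  by rewrite goo poweRyr ?invr_eq0 ?gt_eqF// addey ?leey// gt_eqF//
    (lt_le_trans _ (poweR_ge0 _ _)).
have ff := integral_poweR_lty_ae_fin mf f0 p0.
have gf := integral_poweR_lty_ae_fin mg g0 p0.
move: ff gf; rewrite -!ltey in fNoo gNoo * => /(_ fNoo) ff /(_ gNoo) gf.
have mff : measurable_fun setT (fine \o f) by exact: measurableT_comp.
have mgf : measurable_fun setT (fine \o g) by exact: measurableT_comp.
rewrite (integral_poweR_Lnorm p mf mff)//;
  rewrite (integral_poweR_Lnorm p mg mgf)//.
rewrite (@integral_poweR_Lnorm (f \+ g) ((fine \o f) \+ (fine \o g))%R)//.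
- exact: minkowski_EFin.
- exact: emeasurable_funD.
- exact: measurable_funD.
- by move=> x; exact: adde_ge0.
- by apply: filterS2 ff gf => x /= fx gx; rewrite EFinD -fx -gx.
Qed.

Lemma hoelder_ge0 f g p q : measurable_fun setT f -> measurable_fun setT g ->
  (forall x, 0 <= f x) -> (forall x, 0 <= g x) ->
  (0 < p)%R -> (0 < q)%R -> (p^-1 + q^-1 = 1)%R ->
  \int[mu]_x (f x * g x) <=
  (\int[mu]_x (f x `^ p)) `^ p^-1 * (\int[mu]_x (g x `^ q)) `^ q^-1.
Proof.
move=> mf mg f0 g0 p0 q0 pq.
have i0 u r : 0 <= \int[mu]_x (u x `^ r).
  by apply: integral_ge0 => x _; exact: poweR_ge0.
have mfg : measurable_fun setT (fun x => f x * g x) by exact: emeasurable_funM.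
have fg0 x : 0 <= f x * g x by exact: mule_ge0.
have zero : {ae mu, forall x, f x * g x = 0} -> \int[mu]_x (f x * g x) <=
  (\int[mu]_x (f x `^ p)) `^ p^-1 * (\int[mu]_x (g x `^ q)) `^ q^-1.
  move=> fg; rewrite (_ : integral _ _ _ = 0) ?mule_ge0 ?poweR_ge0//.
  rewrite -(integral0 mu setT); apply: ge0_ae_eq_integral => //.
  by apply: filterS fg => x fgx _.
(* Vanishing factors come first: 0 times +oo is 0 on the right, so an infinite factor gives a
   trivial bound only once both factors are positive. *)
have [fz|fN0] := eqVneq (\int[mu]_x (f x `^ p)) 0.
  apply: zero; apply: filterS (integral_poweR_eq0_ae mf f0 fz) => x ->.
  by rewrite mul0e.
have [gz|gN0] := eqVneq (\int[mu]_x (g x `^ q)) 0.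
  apply: zero; apply: filterS (integral_poweR_eq0_ae mg g0 gz) => x ->.
  by rewrite mule0.
have f_gt0 : 0 < (\int[mu]_x (f x `^ p)) `^ p^-1.
  by apply: poweR_gt0; rewrite lt0e fN0 i0.
have g_gt0 : 0 < (\int[mu]_x (g x `^ q)) `^ q^-1.
  by apply: poweR_gt0; rewrite lt0e gN0 i0.
have [foo|fNoo] := eqVneq (\int[mu]_x (f x `^ p)) +oo.
  by rewrite foo poweRyr ?invr_eq0 ?gt_eqF// gt0_mulye ?leey.
have [goo|gNoo] := eqVneq (\int[mu]_x (g x `^ q)) +oo.
  by rewrite goo poweRyr ?invr_eq0 ?gt_eqF// gt0_muley ?leey.
have ff := integral_poweR_lty_ae_fin mf f0 p0.
have gf := integral_poweR_lty_ae_fin mg g0 q0.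
move: ff gf; rewrite -!ltey in fNoo gNoo * => /(_ fNoo) ff /(_ gNoo) gf.
have mff : measurable_fun setT (fine \o f) by exact: measurableT_comp.
have mgf : measurable_fun setT (fine \o g) by exact: measurableT_comp.
rewrite (integral_poweR_Lnorm p mf mff)//;
  rewrite (integral_poweR_Lnorm q mg mgf)//.
have := @integral_poweR_Lnorm (f \* g) ((fine \o f) \* (fine \o g))%R 1%R.
rewrite invr1 poweRe1//.
under eq_integral do rewrite poweRe1//.
move=> -> //.
- exact: hoelder.
- exact: measurable_funM.
- by apply: filterS2 ff gf => x /= fx gx; rewrite EFinM -fx -gx.
Qed.

(** Hoelder's inequality for w h = w^(1-1/q) (w^(1/q) h), raised to the power q. The weight [w] is
    not normalised, which produces the factor with exponent q - 1. *)
Lemma jensen_poweR_weighted w h q : measurable_fun setT w ->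
  measurable_fun setT h ->
  (forall x, 0 <= w x) -> (forall x, 0 <= h x) -> (1 <= q)%R ->
  (\int[mu]_x (w x * h x)) `^ q <=
  (\int[mu]_x w x) `^ (q - 1) * \int[mu]_x (w x * h x `^ q).
Proof.
move=> mw mh w0 h0; rewrite le_eqVlt => /predU1P[<-|q1].
  rewrite subrr poweRe0 mul1e poweRe1; last first.
    by apply: integral_ge0 => x _; exact: mule_ge0.
  by under [leRHS]eq_integral do rewrite poweRe1//.
have q0 : (0 < q)%R by exact: lt_trans q1.
(* The inverse of the exponent conjugate to [q]; it is positive because the case [q = 1] has been
   split off. *)
pose a := (1 - q^-1)%R.
have a0 : (0 < a)%R by rewrite subr_gt0 invf_lt1.
have wE x : w x = w x `^ a * w x `^ q^-1.
  by rewrite -poweRD /a ?subrK ?poweRe1// poweRD_defE subrK oner_eq0.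
have H : \int[mu]_x (w x * h x) <=
    (\int[mu]_x w x) `^ a * (\int[mu]_x (w x * h x `^ q)) `^ q^-1.
  have := @hoelder_ge0 (fun x => w x `^ a) (fun x => w x `^ q^-1 * h x) a^-1 q.
  rewrite !invrK subrK.
  under eq_integral do rewrite muleA -wE.
  under [\int[mu]_x ((_ `^ a) `^ _)]eq_integral do
    rewrite -poweRrM mulfV ?gt_eqF// poweRe1//.
  under [\int[mu]_x ((_ * _) `^ q)]eq_integral do
    rewrite poweRM ?poweR_ge0// -poweRrM mulVf ?gt_eqF// poweRe1//.
  apply => //; last by rewrite invr_gt0.
  - exact: measurable_fun_poweR.
  - by apply: emeasurable_funM => //; exact: measurable_fun_poweR.
  - by move=> x; exact: poweR_ge0.
  - by move=> x; rewrite mule_ge0 ?poweR_ge0.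
have wh0 : 0 <= \int[mu]_x (w x * h x).
  by apply: integral_ge0 => x _; exact: mule_ge0.
apply: le_trans (le_poweR (ltW q0) wh0 H) _.
rewrite poweRM ?poweR_ge0// -!poweRrM mulVf ?gt_eqF//
  mulrBl mul1r mulVf ?gt_eqF//.
by rewrite poweRe1//; apply: integral_ge0 => x _; rewrite mule_ge0 ?poweR_ge0.
Qed.

End ereal_integral_inequalities.

(** * Iteration of Volterra inequalities in L^p *)

(** The induction only adds terms and never subtracts, so infinite values are allowed; [B n] is the
    remainder after [n] steps. *)
Lemma le_telescope (R : realType) (a b : \bar R) (u B : nat -> \bar R) n :
  a <= b + B 0%N -> (forall m, B m <= u m + B m.+1) ->
  a <= b + \sum_(0 <= i < n) u i + B n.
Proof.
move=> aB0 BS; elim: n => [|n IH]; first by rewrite big_nil adde0.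
by apply: le_trans IH _; rewrite big_nat_recr//= addeA -[leRHS]addeA leeD2l.
Qed.

Lemma ge_telescope (R : realType) (a b : \bar R) (u B : nat -> \bar R) n :
  b + B 0%N <= a -> (forall m, u m + B m.+1 <= B m) ->
  b + \sum_(0 <= i < n) u i + B n <= a.
Proof.
move=> aB0 BS; elim: n => [|n IH]; first by rewrite big_nil adde0.
by apply: le_trans IH; rewrite big_nat_recr//= addeA -[leLHS]addeA leeD2l.
Qed.

(** * Nonnegative kernels as operators, and their composition *)

Section kernel_operators.
Context d (T : measurableType d) (R : realType).
Variable mu : {sigma_finite_measure set T -> \bar R}.
Implicit Types (K L : T -> T -> \bar R) (f g v : T -> \bar R).

Definition ge0_measurable_kernel K :=
  measurable_fun setT (fun ts : T * T => K ts.1 ts.2) /\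
  (forall t s, 0 <= K t s).

Definition kernel_op K f t := \int[mu]_s (K t s * f s).

Definition kernel_comp K L t s := kernel_op K (L^~ s) t.

(* The exponent is shifted: [kernel_exp K n] is the iterated kernel of order
   [n.+1]. *)
Fixpoint kernel_exp K n : T -> T -> \bar R :=
  if n is m.+1 then kernel_comp K (kernel_exp K m) else K.

Lemma measurable_kernelr K t : ge0_measurable_kernel K ->
  measurable_fun setT (K t).
Proof. by move=> [mK _]; exact: (measurableT_comp mK (pair1_measurable t)). Qed.

Lemma measurable_kernell K s :
  ge0_measurable_kernel K -> measurable_fun setT (K^~ s).
Proof. by move=> [mK _]; exact: (measurableT_comp mK (pair2_measurable s)). Qed.

Lemma kernel_op_ge0 K f t : ge0_measurable_kernel K -> (forall s, 0 <= f s) ->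
  0 <= kernel_op K f t.
Proof. by move=> [_ K0] f0; apply: integral_ge0 => s _; exact: mule_ge0. Qed.

Lemma measurable_kernel_op K f : ge0_measurable_kernel K ->
  measurable_fun setT f -> (forall s, 0 <= f s) ->
  measurable_fun setT (kernel_op K f).
Proof.
move=> [mK K0] mf f0.
apply: (measurable_fun_fubini_tonelli_F
  (fun ts => K ts.1 ts.2 * f ts.2)) => [|ts]; last exact: mule_ge0.
by apply: emeasurable_funM => //; exact: measurableT_comp.
Qed.

Lemma le_kernel_op K f g t : ge0_measurable_kernel K ->
  measurable_fun setT f -> measurable_fun setT g ->
  (forall s, 0 <= f s) -> (forall s, 0 <= g s) ->
  {ae mu, forall s, f s <= g s} -> kernel_op K f t <= kernel_op K g t.
Proof.
move=> hK mf mg f0 g0 fg; have [_ K0] := hK.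
have mKt := measurable_kernelr t hK.
apply: ae_ge0_le_integral => //.
- by move=> s _; exact: mule_ge0.
- exact: emeasurable_funM.
- by move=> s _; exact: mule_ge0.
- exact: emeasurable_funM.
- by apply: filterS fg => s fgs _; exact: lee_wpmul2l.
Qed.

Lemma measurable_kernel_comp K L : ge0_measurable_kernel K ->
  ge0_measurable_kernel L ->
  ge0_measurable_kernel (kernel_comp K L).
Proof.
move=> [mK K0] [mL L0]; split=> [|t s]; last exact: kernel_op_ge0.
(* The point [z] stands for ((t, s), x), with x the variable integrated out. *)
apply: (measurable_fun_fubini_tonelli_F
  (fun z => K z.1.1 z.2 * L z.2 z.1.2)) => [|z]; last exact: mule_ge0.
have m13 : measurable_fun setT (fun z : (T * T) * T => (z.1.1, z.2)).
  by apply: measurable_fun_pair => //; exact: measurableT_comp.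
have m32 : measurable_fun setT (fun z : (T * T) * T => (z.2, z.1.2)).
  by apply: measurable_fun_pair => //; exact: measurableT_comp.
apply: emeasurable_funM; first exact: (measurableT_comp mK m13).
exact: (measurableT_comp mL m32).
Qed.

(** Tonelli: both sides are iterated integrals of K(t,x) L(x,s) f(s), in the two orders. *)
Lemma kernel_op_comp K L f t : ge0_measurable_kernel K ->
  ge0_measurable_kernel L ->
  measurable_fun setT f -> (forall s, 0 <= f s) ->
  kernel_op (kernel_comp K L) f t = kernel_op K (kernel_op L f) t.
Proof.
move=> hK hL mf f0; have [[mK K0] [mL L0]] := (hK, hL).
have mKt := measurable_kernelr t hK.
pose F z := K t z.1 * (L z.1 z.2 * f z.2).
have F0 z : 0 <= F z by rewrite /F !mule_ge0.
have mF : measurable_fun setT F.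
  apply: emeasurable_funM; first exact: measurableT_comp.
  by apply: emeasurable_funM => //; exact: measurableT_comp.
transitivity (\int[mu]_s \int[mu]_x F (x, s)).
  apply: eq_integral => s _.
  rewrite /kernel_comp /kernel_op -ge0_integralZr//.
  - by apply: eq_integral => x _; rewrite /F/= muleA.
  - by apply: emeasurable_funM => //; exact: measurable_kernell.
  - by move=> x _; exact: mule_ge0.
transitivity (\int[mu]_x \int[mu]_s F (x, s)).
  exact/esym/(fubini_tonelli F mF F0).
apply: eq_integral => x _; rewrite -ge0_integralZl//.
- by apply: emeasurable_funM => //; exact: measurable_kernelr.
- by move=> s _; exact: mule_ge0.
Qed.

Lemma measurable_kernel_exp K n : ge0_measurable_kernel K ->
  ge0_measurable_kernel (kernel_exp K n).
Proof.
by move=> hK; elim: n => //= n; exact: measurable_kernel_comp.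
Qed.

(** [kernel_exp] adds its factors on the left, while substituting an inequality into itself adds a
    factor next to [f]; associativity moves it there. *)
Lemma kernel_op_expSr K n f t : ge0_measurable_kernel K ->
  measurable_fun setT f -> (forall s, 0 <= f s) ->
  kernel_op (kernel_exp K n.+1) f t =
    kernel_op (kernel_exp K n) (kernel_op K f) t.
Proof.
move=> hK mf f0.
elim: n t => [|n IH] t; first exact: kernel_op_comp.
have hKn := measurable_kernel_exp _ hK.
transitivity (kernel_op K (kernel_op (kernel_exp K n.+1) f) t).
  exact: (kernel_op_comp t hK (hKn n.+1) mf f0).
transitivity (kernel_op K (kernel_op (kernel_exp K n) (kernel_op K f)) t).
  by congr (kernel_op K _ t); exact/funext.
apply/esym/(kernel_op_comp t hK (hKn n)); first exact: measurable_kernel_op.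
by move=> s; exact: kernel_op_ge0.
Qed.

(** Tonelli shifts the integration in x onto the kernel; this is how [trace_kernel] arises from its
    weight. *)
Lemma integral_weight_kernel_op (D : set T) K (W : T -> \bar R) f :
  measurable D -> ge0_measurable_kernel K -> measurable_fun setT W ->
  (forall x, 0 <= W x) -> measurable_fun setT f -> (forall s, 0 <= f s) ->
  \int[mu]_(x in D) (W x * kernel_op K f x) =
  \int[mu]_s ((\int[mu]_(x in D) (W x * K x s)) * f s).
Proof.
move=> mD hK mW W0 mf f0; have [mK K0] := hK.
pose W' := W \_ D.
have mW' : measurable_fun setT W'.
  by apply/(measurable_restrictT _ _).1 => //; exact: measurable_funTS.
have W'0 x : 0 <= W' x by rewrite /W' patchE; case: ifP.
pose F z := W' z.1 * (K z.1 z.2 * f z.2).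
have F0 z : 0 <= F z by rewrite /F !mule_ge0.
have mF : measurable_fun setT F.
  apply: emeasurable_funM; first exact: measurableT_comp.
  by apply: emeasurable_funM => //; exact: measurableT_comp.
transitivity (\int[mu]_x \int[mu]_s F (x, s)).
  rewrite integral_mkcond; apply: eq_integral => x _.
  rewrite /F /= ge0_integralZl//.
  - by rewrite /= /W' !patchE; case: ifP; rewrite ?mul0e.
  - by apply: emeasurable_funM => //; exact: measurable_kernelr.
  - by move=> s _; rewrite mule_ge0.
rewrite (fubini_tonelli F mF F0).
apply: eq_integral => s _.
transitivity (\int[mu]_x ((W' x * K x s) * f s)).
  by apply: eq_integral => x _; rewrite /F /= muleA.
rewrite ge0_integralZr//.
- congr (_ * _); rewrite [RHS]integral_mkcond.
  by apply: eq_integral => x _; rewrite /W' !patchE; case: ifP; rewrite ?mul0e.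
- by apply: emeasurable_funM => //; exact: measurable_kernell.
- by move=> x _; rewrite mule_ge0.
Qed.

(** * The nonlinear operator T and its iterates in L^p over D *)

Section iteration.
Variables (K : T -> T -> \bar R) (D : set T) (p beta : R).
Hypotheses (hK : ge0_measurable_kernel K) (mD : measurable D)
  (beta1 : (1 <= beta)%R) (betap : (beta <= p)%R).

Let beta0 : (0 < beta)%R. Proof. exact: lt_le_trans beta1. Qed.
Let p1 : (1 <= p)%R. Proof. exact: le_trans betap. Qed.
Let p0 : (0 < p)%R. Proof. exact: lt_le_trans p1. Qed.
Let q1 : (1 <= p / beta)%R. Proof. by rewrite ler_pdivlMr// mul1r. Qed.

(* For D = [0,t] and K the extension by 0 of l^beta, this is
   l_{mu,n+1,beta,p}(t, s); the case beta = p needs no distinction since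
   y^0 = 1 for all y in [0,+oo]. *)
Definition trace_kernel n s := \int[mu]_(x in D)
  (kernel_op (kernel_exp K n) (cst 1) x `^ (p / beta - 1) * kernel_exp K n x s).

Lemma trace_kernel_ge0 n s : 0 <= trace_kernel n s.
Proof.
apply: integral_ge0 => x _; rewrite mule_ge0 ?poweR_ge0//.
exact: (measurable_kernel_exp n hK).2.
Qed.

(** With [K] in the role of l^beta this is T^(n+1): between two applications of T the exponents
    1/beta and beta cancel, so only the outermost root remains. In particular [root_op 0] is T. *)
Definition root_op n f t := kernel_op (kernel_exp K n) (fun s => f s `^ beta) t
  `^ beta^-1.

Let normD f := (\int[mu]_(x in D) (f x `^ p)) `^ p^-1.

Lemma measurable_root_op n f : measurable_fun setT f ->
  measurable_fun setT (root_op n f).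
Proof.
move=> mf; apply: measurable_fun_poweR; apply: measurable_kernel_op.
- exact: measurable_kernel_exp.
- exact: measurable_fun_poweR.
- by move=> s; exact: poweR_ge0.
Qed.

(** T^(n+1) is monotone and, by Minkowski's inequality in L^beta, subadditive. The hypothesis is
    used only under the integral, so holding almost everywhere is enough for a bound at every
    [t]. *)
Lemma root_op_recursion n v (x0 : T -> \bar R) t : measurable_fun setT v ->
  measurable_fun setT x0 -> (forall s, 0 <= v s) -> (forall s, 0 <= x0 s) ->
  {ae mu, forall s, x0 s <= v s + root_op 0 x0 s} ->
  root_op n x0 t <= root_op n v t + root_op n.+1 x0 t.
Proof.
move=> mv mx0 v0 x00 xv.
have hKn := measurable_kernel_exp n hK; have [_ Kn0] := hKn.
have mKnt := measurable_kernelr t hKn.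
have mr := measurable_root_op 0 mx0.
have r0 s : 0 <= root_op 0 x0 s by exact: poweR_ge0.
apply: (@le_trans _ _ (root_op n (fun s => v s + root_op 0 x0 s) t)).
  apply: le_poweR; first by rewrite invr_ge0 ltW.
    by apply: kernel_op_ge0 => // s; exact: poweR_ge0.
  apply: le_kernel_op => //; try by move=> s; exact: poweR_ge0.
  - exact: measurable_fun_poweR.
  - by apply: measurable_fun_poweR; exact: emeasurable_funD.
  - by apply: filterS xv => s xvs; apply: le_poweR => //; exact: ltW.
(* The density [kernel_exp K n t s] enters the power as its root, so that Minkowski's inequality can
   be used for [mu] itself. *)
have rootE f : (forall s, 0 <= f s) -> root_op n f t =
    (\int[mu]_s ((kernel_exp K n t s `^ beta^-1 * f s) `^ beta)) `^ beta^-1.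
  move=> f0; congr (_ `^ _); apply: eq_integral => s _.
  by rewrite poweRM ?poweR_ge0// -poweRrM mulVf ?gt_eqF// poweRe1.
have -> : root_op n.+1 x0 t = root_op n (root_op 0 x0) t.
  rewrite /root_op kernel_op_expSr//; last 2 first.
    - exact: measurable_fun_poweR.
    - by move=> s; exact: poweR_ge0.
  congr (_ `^ _); apply: eq_integral => s _; congr (_ * _).
  rewrite -poweRrM mulVf ?gt_eqF// poweRe1//.
  by apply: kernel_op_ge0 => // r; exact: poweR_ge0.
rewrite !rootE//; last by move=> s; exact: adde_ge0.
under eq_integral do rewrite ge0_muleDr//.
apply: minkowski_ge0 => //.
- by apply: emeasurable_funM => //; exact: measurable_fun_poweR.
- by apply: emeasurable_funM => //; exact: measurable_fun_poweR.
- by move=> s; rewrite mule_ge0 ?poweR_ge0.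
- by move=> s; rewrite mule_ge0 ?poweR_ge0.
Qed.

Lemma normD_triangle f g h : measurable_fun setT f ->
  measurable_fun setT g -> measurable_fun setT h ->
  (forall s, 0 <= f s) -> (forall s, 0 <= g s) -> (forall s, 0 <= h s) ->
  {ae mu, forall s, f s <= g s + h s} -> normD f <= normD g + normD h.
Proof.
move=> mf mg mh f0 g0 h0 fgh.
have normDE u : normD u = (\int[mu]_x ((u \_ D) x `^ p)) `^ p^-1.
  rewrite /normD integral_mkcond; congr (_ `^ _); apply: eq_integral => x _.
  by rewrite !patchE; case: ifP => //; rewrite poweR0r// gt_eqF.
have mres (u : T -> \bar R) : measurable_fun setT u ->
  measurable_fun setT (u \_ D).
  by move=> mu_; apply/(measurable_restrictT _ _).1 => //;
    exact: measurable_funTS.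
have res0 (u : T -> \bar R) : (forall s, 0 <= u s) -> forall s, 0 <= (u \_ D) s.
  by move=> u0 s; rewrite patchE; case: ifP.
apply: (@le_trans _ _ (normD (fun s => g s + h s))).
  apply: le_poweR; first by rewrite invr_ge0 ltW.
    by apply: integral_ge0 => x _; exact: poweR_ge0.
  apply: ae_ge0_le_integral => //.
  - by move=> x _; exact: poweR_ge0.
  - by apply: measurable_funTS; exact: measurable_fun_poweR.
  - by move=> x _; exact: poweR_ge0.
  - by apply: measurable_funTS; apply: measurable_fun_poweR;
    exact: emeasurable_funD.
  - by apply: filterS fgh => s fghs _; apply: le_poweR => //; exact: ltW.
rewrite !normDE erestrictD; apply: minkowski_ge0 => //;
  do ?[exact: mres|exact: res0].
Qed.

(** The p-th power of [root_op n f] at x is the power p/beta >= 1 of an integral with weight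
    [kernel_exp K n x]. Jensen moves this exponent inside at the price of the total weight to the
    power p/beta - 1, and Tonelli collects the weights into [trace_kernel]. *)
Lemma normD_root_op n f : measurable_fun setT f -> (forall s, 0 <= f s) ->
  normD (root_op n f) <= (\int[mu]_s (trace_kernel n s * f s `^ p)) `^ p^-1.
Proof.
move=> mf f0.
have hKn := measurable_kernel_exp n hK; have [mKn Kn0] := hKn.
have m1 : measurable_fun setT (kernel_op (kernel_exp K n) (cst 1)).
  by apply: measurable_kernel_op.
have mfp : measurable_fun setT (fun s => f s `^ p) by exact:
  measurable_fun_poweR.
pose W x := kernel_op (kernel_exp K n) (cst 1) x `^ (p / beta - 1).
have mW : measurable_fun setT W by exact: measurable_fun_poweR.
have W0 x : 0 <= W x by exact: poweR_ge0.
apply: le_poweR; first by rewrite invr_ge0 ltW.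
  by apply: integral_ge0 => x _; exact: poweR_ge0.
apply: (@le_trans _ _ (\int[mu]_(x in D)
    (W x * kernel_op (kernel_exp K n) (fun s => f s `^ p) x))).
  apply: ge0_le_integral => //.
  - by move=> x _; exact: poweR_ge0.
  - by apply: measurable_funTS; apply: measurable_fun_poweR;
    exact: measurable_root_op.
  - apply: measurable_funTS; apply: emeasurable_funM => //.
    by apply: measurable_kernel_op => // s; exact: poweR_ge0.
  - move=> x _; rewrite /root_op -poweRrM mulrC.
    have := @jensen_poweR_weighted _ _ _ mu (kernel_exp K n x)
      (fun s => f s `^ beta) (p / beta) (measurable_kernelr x hKn).
    under [\int[mu]_s (_ * (_ `^ _) `^ _)]eq_integral do
      rewrite -poweRrM mulrC mulfVK ?gt_eqF//.
    rewrite /W (_ : kernel_op _ (cst 1) x = \int[mu]_s kernel_exp K n x s).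
      apply => //; first exact: measurable_fun_poweR.
      by move=> s; exact: poweR_ge0.
    by apply: eq_integral => s _; rewrite mule1.
by rewrite integral_weight_kernel_op// => s; exact: poweR_ge0.
Qed.

(** Telescoping in the norm over [D]; x0 <= x turns the bound on [x] into x0 <= v + T x0, which can
    be iterated. *)
Lemma norm_iteration_bound n v (x x0 : T -> \bar R) : measurable_fun setT v ->
  measurable_fun setT x -> measurable_fun setT x0 ->
  (forall s, 0 <= v s) -> (forall s, 0 <= x s) -> (forall s, 0 <= x0 s) ->
  {ae mu, forall s, x0 s <= x s} ->
  {ae mu, forall s, x s <= v s + root_op 0 x0 s} ->
  normD x <= normD v +
    \sum_(0 <= i < n) (\int[mu]_s (trace_kernel i s * v s `^ p)) `^ p^-1 +
    (\int[mu]_s (trace_kernel n s * x0 s `^ p)) `^ p^-1.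
Proof.
move=> mv mx mx0 v0 xge0 x00 x0x xv.
have r0 m f s : 0 <= root_op m f s by exact: poweR_ge0.
have x0v : {ae mu, forall s, x0 s <= v s + root_op 0 x0 s}.
  by apply: filterS2 x0x xv => s; exact: le_trans.
(* The recursion needs the exact norm of the remainder; its bound by [trace_kernel] is inserted only
   after the last step. *)
suff H : normD x <= normD v +
    \sum_(0 <= i < n) (\int[mu]_s (trace_kernel i s * v s `^ p)) `^ p^-1 +
    normD (root_op n x0).
  by apply: le_trans H _; rewrite leeD2l//; exact: normD_root_op.
apply: (le_telescope (B := fun m => normD (root_op m x0))).
  by apply: normD_triangle => //; exact: measurable_root_op.
move=> m; apply: (@le_trans _ _ (normD (root_op m v) + normD (root_op m.+1
  x0))).
  apply: normD_triangle => //; try exact: measurable_root_op.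
  by apply: aeW => s; exact: root_op_recursion.
by rewrite leeD2r//; exact: normD_root_op.
Qed.

End iteration.

(** The reverse estimate in the linear case beta = p = 1: the same telescoping runs with v + K f <=
    f, and the remainder is dropped because it is nonnegative. *)
Lemma integral_iteration_lower K (D : set T) n v f :
  ge0_measurable_kernel K -> measurable D ->
  measurable_fun setT v -> measurable_fun setT f ->
  (forall s, 0 <= v s) -> (forall s, 0 <= f s) ->
  {ae mu, forall s, v s + kernel_op K f s <= f s} ->
  \int[mu]_(x in D) v x +
    \sum_(0 <= i < n) \int[mu]_s (trace_kernel K D 1 1 i s * v s) <=
  \int[mu]_(x in D) f x.
Proof.
move=> hK mD mv mf v0 f0 vf.
have hKn m := measurable_kernel_exp m hK.
have mKn m g := @measurable_kernel_op _ g (hKn m).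
have Kn0 m g x := @kernel_op_ge0 _ g x (hKn m).
have opE m : \int[mu]_(x in D) kernel_op (kernel_exp K m) v x =
    \int[mu]_s (trace_kernel K D 1 1 m s * v s).
  transitivity (\int[mu]_(x in D) (cst 1 x * kernel_op (kernel_exp K m) v x)).
    by apply: eq_integral => x _; rewrite mul1e.
  transitivity (\int[mu]_s
      ((\int[mu]_(x in D) (cst 1 x * kernel_exp K m x s)) * v s)).
    by apply: integral_weight_kernel_op mv v0 => // x; exact: lee01.
  apply: eq_integral => s _; congr (_ * _); apply: eq_integral => x _.
  by rewrite divr1 subrr poweRe0.
suff H : \int[mu]_(x in D) v x +
    \sum_(0 <= i < n) \int[mu]_s (trace_kernel K D 1 1 i s * v s) +
    \int[mu]_(x in D) kernel_op (kernel_exp K n) f x <= \int[mu]_(x in D) f x.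
  apply: le_trans H; rewrite leeDl//.
  by apply: integral_ge0 => x _; exact: Kn0.
have vKf0 s : 0 <= v s + kernel_op K f s by rewrite adde_ge0 ?kernel_op_ge0.
have mvKf : measurable_fun setT (fun s => v s + kernel_op K f s).
  by apply: emeasurable_funD => //; exact: measurable_kernel_op.
apply: (ge_telescope
    (B := fun m => \int[mu]_(x in D) kernel_op (kernel_exp K m) f x)).
  rewrite -ge0_integralD//=.
  - by apply: ae_ge0_le_integral => //; [exact: measurable_funTS|
      exact: measurable_funTS|apply: filterS vf].
  - exact: measurable_funTS.
  - by move=> x _; exact: kernel_op_ge0.
  - by apply: measurable_funTS; exact: measurable_kernel_op.
clear n => n; rewrite -opE -ge0_integralD//.
- apply: ge0_le_integral => //.
  + by move=> x _; rewrite adde_ge0// Kn0.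
  + by apply: measurable_funTS; apply: emeasurable_funD;
    [exact: mKn|exact: (mKn n.+1)].
  + by apply: measurable_funTS; exact: mKn.
  (* With L the operator of [kernel_exp K n], additivity gives L v + L (K f) = L (v + K f), which is
     at most L f. *)
  + move=> x _; rewrite -/(kernel_exp K n.+1) kernel_op_expSr//.
    rewrite -ge0_integralD//; last 4 first.
    * by move=> s _; apply: mule_ge0 => //; exact: (hKn n).2.
    * by apply: emeasurable_funM => //; exact: measurable_kernelr.
    * by move=> s _; apply: mule_ge0; [exact: (hKn n).2|exact: kernel_op_ge0].
    * by apply: emeasurable_funM;
      [exact: measurable_kernelr|exact: measurable_kernel_op].
    under eq_integral do rewrite -ge0_muleDr ?kernel_op_ge0//.
    exact: le_kernel_op.
- by move=> x _; exact: Kn0.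
- by apply: measurable_funTS; exact: mKn.
- by move=> x _; exact: (Kn0 n.+1).
- by apply: measurable_funTS; exact: (mKn n.+1).
Qed.
End kernel_operators.

(** * Passage from partial sums to the infinite series *)

Lemma le_series_of_partial (R : realType) (a b : \bar R) (u e : nat -> \bar R)
    (r : R) : (0 < r)%R -> 0 <= b -> (forall n, 0 <= u n) ->
  (forall n, 0 <= e n.+1) -> e @ \oo --> 0 ->
  (forall n, a <= b + \sum_(0 <= i < n) u i.+1 + e n.+1 `^ r) ->
  a <= b + \sum_(1 <= i <oo) u i.
Proof.
move=> r0 b0 u0 e0 elim0 H.
apply/lee_addgt0Pr => eps eps0.
(* The threshold eps^(1/r) makes the remainder, an r-th power, at most eps. A single index suffices,
   since every partial sum lies below the series. *)
have : \forall n \near \oo, e n < (eps `^ r^-1)%:E.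
  by apply: (elim0 [set z | z < _]); apply: open_ereal_lt';
    rewrite lte_fin powR_gt0.
move=> [N _ /(_ N.+1 (leqnSn N)) /= eN].
apply: le_trans (H N) _; apply: leeD.
  have -> : \sum_(0 <= i < N) u i.+1 = \sum_(1 <= i < N.+1) u i.
    by rewrite big_add1.
  apply: leeD2l; apply: nneseries_lim_ge => *; exact: u0.
have -> : eps%:E = (eps `^ r^-1)%:E `^ r.
  by rewrite -poweR_EFin -poweRrM mulVf ?gt_eqF// poweRe1// lee_fin ltW.
by apply: le_poweR => //; exact: ltW.
Qed.

Lemma ge_series_of_partial (R : realType) (a b : \bar R) (u : nat -> \bar R) :
  0 <= b -> (forall n, 0 <= u n) ->
  (forall n, b + \sum_(0 <= i < n) u i.+1 <= a) ->
  b + \sum_(1 <= i <oo) u i <= a.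
Proof.
move=> b0 u0 H.
have cu : cvgn (fun n => \sum_(1 <= i < n) u i) by exact: is_cvg_nneseries.
have s0 : 0 <= \sum_(1 <= i <oo) u i by exact: nneseries_ge0.
have bu : (fun n => b + \sum_(1 <= i < n) u i) @ \oo -->
    b + \sum_(1 <= i <oo) u i.
  by apply: cvgeD => //; [exact: ge0_adde_def|exact: cvg_cst].
rewrite -(cvg_lim _ bu)//; apply: lime_le; first by apply/cvg_ex; eexists;
  exact: bu.
near=> n; have n0 : (0 < n)%N by near: n; exists 1%N.
by rewrite -(prednK n0) big_add1; exact: H.
Unshelve. all: by end_near. Qed.

(** * Kernels on the triangle of a time interval *)

Section volterra_kernels.
Context (R : realType) (I : set R).
Hypothesis hI : time_interval I.
Variable mu : {sigma_finite_measure set (measurableTypeR R) -> \bar R}.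
Implicit Types (k l : R -> R -> \bar R) (beta : R).

Definition triangle_kernel k beta (t s : measurableTypeR R) : \bar R :=
  ((fun ts => k ts.1 ts.2 `^ beta) \_ (triangle I)) (t, s).

Lemma time_intervalP t x : I t -> (0 <= x <= t)%R -> I x.
Proof. by case: hI => itvI _ I0 _ It; exact: itvI. Qed.

Lemma measurable_time_interval : measurable (I : set (measurableTypeR R)).
Proof. by case: hI => itvI _ _ _; exact: is_interval_measurable. Qed.

Lemma measurable_triangle : measurable (triangle I).
Proof.
have mI := measurable_time_interval.
rewrite (_ : triangle I = (I `*` I) `&`
    [set ts : measurableTypeR R * measurableTypeR R | (ts.2 <= ts.1)%R]);
      last first.
  by apply/seteqP; split => -[t s] /= => [[]//|[[]]].
apply: measurableI; first exact: measurableX.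
have := @measurable_fun_ler _ _ R setT
  (snd : measurableTypeR R * measurableTypeR R -> _) fst.
move=> /(_ measurable_snd measurable_fst)/(_ measurableT [set true]).
by rewrite setTI; exact.
Qed.

Lemma triangle_kernelE k beta t s : triangle I (t, s) ->
  triangle_kernel k beta t s = k t s `^ beta.
Proof. by move=> ts; rewrite /triangle_kernel patchE mem_set. Qed.

Lemma triangle_kernel0 k beta t s : ~ triangle I (t, s) ->
  triangle_kernel k beta t s = 0.
Proof. by move=> ts; rewrite /triangle_kernel patchE memNset. Qed.

Lemma measurable_triangle_kernel k beta : nonneg_kernel I k ->
  ge0_measurable_kernel (triangle_kernel k beta).
Proof.
move=> [mk k0]; split=> [|t s]; last first.
  by rewrite /triangle_kernel patchE; case: ifP => // _; exact: poweR_ge0.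
rewrite (_ : (fun _ => _) = (fun ts => k ts.1 ts.2 `^ beta) \_ (triangle I)).
  apply/(measurable_restrictT _ _).1; first exact: measurable_triangle.
  exact: measurable_fun_poweR.
by apply/funext => -[].
Qed.

Lemma triangle_trans t x s : triangle I (t, x) -> triangle I (x, s) ->
  triangle I (t, s).
Proof. by move=> [/= It Ix xt] [/= _ Is sx]; split => //=;
  exact: le_trans xt. Qed.

(** By transitivity, (t, x) and (x, s) cannot both lie in the triangle when (t, s) does not, so one
    factor of each integrand is 0. *)
Lemma kernel_exp_triangle0 k beta n t s : ~ triangle I (t, s) ->
  kernel_exp mu (triangle_kernel k beta) n t s = 0.
Proof.
elim: n t s => [|n IH] t s ts; first exact: triangle_kernel0.
apply: integral0_eq => x _.
rewrite -/(kernel_exp mu (triangle_kernel k beta) n) /=.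
have [tx|tx] := pselect (triangle I (t, x));
  last by rewrite triangle_kernel0 ?mul0e.
by rewrite IH ?mule0// => xs; apply: ts; exact: triangle_trans xs.
Qed.

(** Only x in [s,t] contributes to the integral over the line; there both pairs lie in the triangle
    and the induction hypothesis applies. *)
Lemma kernel_exp_triangle k beta n t s : triangle I (t, s) ->
  kernel_exp mu (triangle_kernel k beta) n t s =
  iterated_kernel mu (fun t' s' => k t' s' `^ beta) n.+1 t s.
Proof.
elim: n t s => [|n IH] t s ts; first exact: triangle_kernelE.
have [/= It Is st] := ts.
transitivity (\int[mu]_(x in `[s, t]) (k t x `^ beta *
  iterated_kernel mu (fun t' s' => k t' s' `^ beta) n.+1 x s)) => //.
rewrite [RHS]integral_mkcond; apply: eq_integral => x _ /=.
rewrite patchE; case: ifPn => [|/negP xst].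
  rewrite inE/= in_itv/= => /andP[sx xt].
  have Ix : I x.
    apply: (time_intervalP It); rewrite xt andbT (le_trans _ sx)//.
    by case: hI => _ /(_ s Is).
  by rewrite triangle_kernelE// IH.
have [tx|tx] := pselect (triangle I (t, x));
  last by rewrite triangle_kernel0 ?mul0e.
rewrite kernel_exp_triangle0 ?mule0// => -[/= _ _ sx].
by apply: xst; rewrite inE/= in_itv/= sx; case: tx.
Qed.

Lemma itv_triangle t s : I t -> triangle I (t, s) <-> s \in `[0%R, t].
Proof.
move=> It; rewrite in_itv/=; split=> [[/= _ Is st]|/andP[s0 st]].
  by rewrite st andbT; case: hI => _ /(_ s Is).
by split => //=; apply: (time_intervalP It); rewrite s0.
Qed.

Lemma integral_itv_triangle_kernel k beta t (f : R -> \bar R) : I t ->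
  \int[mu]_(s in `[0%R, t]) (k t s `^ beta * f s) =
  kernel_op mu (triangle_kernel k beta) f t.
Proof.
move=> It; rewrite integral_mkcond; apply: eq_integral => s _.
rewrite patchE; case: ifPn => [|/negP st].
  by rewrite inE/= => /(itv_triangle s It) ts; rewrite triangle_kernelE.
by rewrite triangle_kernel0 ?mul0e// => /(itv_triangle s It) ts; apply: st;
  rewrite inE.
Qed.

(** Both kernels are built from the same iterates, whose supports cut the integrals down to [s,t]
    and [0,x]. The index drops by one since [kernel_exp] counts from 0. *)
Lemma integral_power_kernel l n beta p t (f : R -> \bar R) : I t ->
  (beta <= p)%R -> (0 < beta)%R ->
  \int[mu]_(s in `[0%R, t]) (power_kernel mu l n.+1 beta p t s * f s) =
  \int[mu]_s (trace_kernel mu (triangle_kernel l beta) `[0%R, t] p beta n s *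
    (f \_ I) s).
Proof.
move=> It betap beta0; rewrite integral_mkcond; apply: eq_integral => s _.
set K := triangle_kernel l beta.
set Rn := iterated_kernel mu (fun t' s' => l t' s' `^ beta) n.+1.
(* For s outside [0,t] no x in [0,t] has (x, s) in the triangle, so the trace kernel is 0 there. *)
rewrite patchE; case: ifPn => [|/negP st]; last first.
  rewrite /trace_kernel integral0_eq ?mul0e// => x /= xt.
  rewrite kernel_exp_triangle0 ?mule0// => xs; apply: st; rewrite inE/=.
  apply/(itv_triangle s It); apply: (triangle_trans _ xs).
  exact/(itv_triangle x It).
rewrite inE/= => st; have ts := (itv_triangle s It).2 st.
have [/= _ Is _] := ts.
rewrite [(f \_ I) s]patchE mem_set//; congr (_ * _).
transitivity (\int[mu]_(x in `[s, t])
    ((\int[mu]_(r in `[0%R, x]) Rn x r) `^ (p / beta - 1) * Rn x s)).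
  (* In the second case beta = p, and the factor with exponent 0 equals 1 even where its base is 0
     or +oo. *)
  rewrite /power_kernel -/Rn; case: ifPn => // /negbTE pb.
  have -> : p = beta by apply/eqP; rewrite eq_le betap andbT leNgt pb.
  by apply: eq_integral => x _; rewrite divff ?gt_eqF// subrr poweRe0 mul1e.
rewrite /trace_kernel integral_mkcond [RHS]integral_mkcond.
apply: eq_integral => x _; rewrite !patchE.
have [xt|xt] := boolP (x \in `[0%R, t]%classic); last first.
  rewrite ifN//; apply: contra xt; rewrite !inE/= !in_itv/= => /andP[sx ->].
  rewrite andbT; apply: le_trans sx.
  by move: st; rewrite in_itv/= => /andP[].
have [/= _ Ix xt'] : triangle I (t, x).
  by apply/(itv_triangle x It); move: xt; rewrite inE.
case: ifPn => [|/negP sxt]; last first.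
  rewrite kernel_exp_triangle0 ?mule0// => -[/= _ _ sx].
  by apply: sxt; rewrite inE/= in_itv/= sx.
rewrite inE/= in_itv/= => /andP[sx _].
have -> : Rn x s = kernel_exp mu K n x s by exact/esym/kernel_exp_triangle.
congr (_ `^ _ * _).
rewrite integral_mkcond; apply: eq_integral => r _.
rewrite patchE mule1; case: ifPn => [|/negP rx].
  rewrite inE/= => rx; apply/esym/kernel_exp_triangle.
  exact/(itv_triangle r Ix).
rewrite kernel_exp_triangle0// => xr; apply: rx; rewrite inE/=.
exact/(itv_triangle r Ix).
Qed.

(** * Measurability of moments and of v *)

Lemma moment_ge0 d (Omega : measurableType d) (P : probability Omega R) (p : R)
  (X : R -> Omega -> \bar R) t : 0 <= moment P p X t.
Proof. by apply: integral_ge0 => w _; exact: poweR_ge0. Qed.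

Lemma measurable_moment d (Omega : measurableType d) (P : probability Omega R)
    (p : R) (X : R -> Omega -> \bar R) : nonneg_process I X ->
  measurable_fun (I : set (measurableTypeR R)) (moment P p X).
Proof.
move=> [mX X0]; have mI := measurable_time_interval.
pose F := (fun tw : measurableTypeR R * Omega => X tw.1 tw.2 `^ p) \_ (I `*`
  setT).
have mF : measurable_fun setT F.
  apply/(measurable_restrictT _ _).1; first exact: measurableX.
  exact: measurable_fun_poweR.
have F0 z : 0 <= F z by rewrite /F patchE; case: ifP => // _; exact: poweR_ge0.
apply: (eq_measurable_fun (fubini_F P F)); last first.
  by apply: measurable_funTS; exact: measurable_fun_fubini_tonelli_F.
move=> t; rewrite inE => It; apply: eq_integral => w _.
by rewrite /F patchE mem_set.
Qed.

Lemma measurable_bound_v d (Omega : measurableType d) (P : probability Omega R)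
    (Y : R -> Omega -> \bar R) k (beta p : R) :
  nonneg_process I Y -> nonneg_kernel I k ->
  measurable_fun (I : set (measurableTypeR R)) (bound_v P mu Y k beta p).
Proof.
move=> hY hk; apply: emeasurable_funD; apply: measurable_fun_poweR.
  exact: measurable_moment.
apply: (eq_measurable_fun (kernel_op mu (triangle_kernel k beta) (cst 1))).
  move=> t; rewrite inE => It; rewrite -integral_itv_triangle_kernel//.
  by apply: eq_integral => s _; rewrite mule1.
apply: measurable_funTS; apply: measurable_kernel_op => //.
exact: measurable_triangle_kernel.
Qed.

End volterra_kernels.

(** * Application to the moments of the processes *)

Theorem corollary3p19 (d : measure_display) (Omega : measurableType d)
    (R : realType) (P : probability Omega R)
    (I : set R) (hI : time_interval I)
    (mu : {sigma_finite_measure set (measurableTypeR R) -> \bar R})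
    (hmu : carried_by mu I)
    (J : set R) (hJ : full_measure mu I J)
    (p beta : R) (hp : (1 <= p)%R) (hbeta : (1 <= beta <= p)%R)
    (Y : R -> Omega -> \bar R) (hY : nonneg_process I Y)
    (k l : R -> R -> \bar R) (hk : nonneg_kernel I k) (hl : nonneg_kernel I l)
    (X X0 : R -> Omega -> \bar R)
    (hX : nonneg_process I X) (hX0 : nonneg_process I X0)
    (hX0X : forall t, J t -> moment P p X0 t <= moment P p X t)
    (h1 : forall t, J t ->
      moment P p X t `^ p^-1 <=
      bound_v P mu Y k beta p t +
      (\int[mu]_(s in `[0%R, t])
         (l t s `^ beta * moment P p X0 s `^ (beta / p))) `^ beta^-1)
    (hlim : forall t, J t ->
      (fun n : nat => \int[mu]_(s in `[0%R, t])
         (power_kernel mu l n beta p t s * moment P p X0 s)) @ \oo --> 0) :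
  (forall t, J t ->
    (\int[mu]_(s in `[0%R, t]) moment P p X s) `^ p^-1 <=
    (\int[mu]_(s in `[0%R, t]) (bound_v P mu Y k beta p s `^ p)) `^ p^-1 +
    \sum_(1 <= n <oo)
      (\int[mu]_(s in `[0%R, t])
         (power_kernel mu l n beta p t s *
          bound_v P mu Y k beta p s `^ p)) `^ p^-1)
  /\
  (beta = 1%R -> p = 1%R ->
   (forall t, J t -> moment P p X0 t = moment P p X t) ->
   (forall t, J t ->
      moment P p X t `^ p^-1 =
      bound_v P mu Y k beta p t +
      (\int[mu]_(s in `[0%R, t])
         (l t s `^ beta * moment P p X0 s `^ (beta / p))) `^ beta^-1) ->
   forall t, J t ->
    (\int[mu]_(s in `[0%R, t]) moment P p X s) `^ p^-1 =
    (\int[mu]_(s in `[0%R, t]) (bound_v P mu Y k beta p s `^ p)) `^ p^-1 +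
    \sum_(1 <= n <oo)
      (\int[mu]_(s in `[0%R, t])
         (power_kernel mu l n beta p t s *
          bound_v P mu Y k beta p s `^ p)) `^ p^-1).
Proof.
have [/andP[beta1 betap] [JI nJ]] := (hbeta, hJ).
have p0 : (0 < p)%R by exact: lt_le_trans hp.
have beta0 : (0 < beta)%R by exact: lt_le_trans beta1.
set v := bound_v P mu Y k beta p in h1 *.
pose K := triangle_kernel I l beta.
have hK : ge0_measurable_kernel K by exact: measurable_triangle_kernel.
(* The functions to be iterated are the p-th roots of the moments, set to 0 outside [I], where the
   processes are unconstrained. *)
pose root (m : R -> \bar R) := (fun t => m t `^ p^-1) \_ I.
pose x := root (moment P p X); pose x0 := root (moment P p X0).
have restr_ge0 (f : R -> \bar R) : (forall s, 0 <= f s) ->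
  forall s, 0 <= (f \_ I) s.
  by move=> f0 s; rewrite patchE; case: ifP.
have mrestr (f : R -> \bar R) : measurable_fun (I : set (measurableTypeR R)) f
  ->
    measurable_fun setT (f \_ I : measurableTypeR R -> \bar R).
  by move=> mf; apply/(measurable_restrictT _ _).1 => //;
    exact: measurable_time_interval.
have v_ge0 s : 0 <= v s by rewrite adde_ge0 ?poweR_ge0.
have v'_ge0 := restr_ge0 v v_ge0.
have mv : measurable_fun setT (v \_ I : measurableTypeR R -> \bar R).
  by apply: mrestr; exact: measurable_bound_v.
have root_ge0 m s : 0 <= root m s.
  by apply: restr_ge0 => r; exact: poweR_ge0.
have mroot Z : nonneg_process I Z ->
    measurable_fun setT (root (moment P p Z) : measurableTypeR R -> \bar R).
  move=> hZ; apply: mrestr; apply: measurable_fun_poweR.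
  exact: measurable_moment.
have rootX Z s : I s -> root (moment P p Z) s `^ p = moment P p Z s.
  move=> Is; rewrite /root patchE mem_set// -poweRrM mulVf ?gt_eqF// poweRe1//.
  exact: moment_ge0.
(* A property valid on [J] and off [I] can fail only on the negligible set [I] minus [J]. Off [I] it
   is checked from the extension by 0. *)
have ae_of_J (Q : R -> Prop) : (forall s, ~ I s -> Q s) ->
    (forall s, J s -> Q s) -> {ae mu, forall s, Q s}.
  move=> QI QJ; apply: negligibleS nJ => s /= nQ; split.
    by apply: contrapT => /QI.
  by move=> /QJ.
(* The last term of (1) is T x0, since (m^(1/p))^beta = m^(beta/p) for the moment m of [X0]. *)
have opE t : J t ->
    (\int[mu]_(s in `[0%R, t])
         (l t s `^ beta * moment P p X0 s `^ (beta / p))) `^ beta^-1 =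
    root_op mu K beta 0 x0 t.
  move=> /JI It; rewrite (integral_itv_triangle_kernel hI)//; congr (_ `^ _).
  apply: eq_integral => s _.
  have [ts|ts] := pselect (triangle I (t, s));
    last by rewrite /K /= triangle_kernel0 ?mul0e.
  have [_ /= Is _] := ts.
  by rewrite /x0 /root patchE mem_set// -poweRrM (mulrC p^-1%R).
have x0x : {ae mu, forall s, x0 s <= x s}.
  apply: ae_of_J => s; rewrite /x0 /x /root !patchE; first by move=> nI;
    rewrite !memNset.
  move=> Js; rewrite mem_set; last exact: JI.
  by apply: le_poweR; [rewrite invr_ge0 ltW|exact: moment_ge0|exact: hX0X].
have xv : {ae mu, forall s, x s <= (v \_ I) s + root_op mu K beta 0 x0 s}.
  apply: ae_of_J => s.
    by move=> nI; rewrite /x /root patchE memNset// adde_ge0 ?poweR_ge0.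
  move=> Js; have Is := JI _ Js.
  by rewrite -opE// /x /root !patchE mem_set//; exact: h1.
have sub t s : I t -> s \in `[0%R, t]%classic -> I s.
  by move=> It; rewrite inE/= in_itv/= => st; exact: (time_intervalP hI It).
have momentE t Z : I t -> \int[mu]_(s in `[0%R, t]) moment P p Z s =
    \int[mu]_(s in `[0%R, t]) (root (moment P p Z) s `^ p).
  by move=> It; apply: eq_integral => s /(sub _ _ It) Is; rewrite rootX.
have vE t : I t -> \int[mu]_(s in `[0%R, t]) (v s `^ p) =
    \int[mu]_(s in `[0%R, t]) ((v \_ I) s `^ p).
  by move=> It; apply: eq_integral => s /(sub _ _ It) Is;
    rewrite patchE mem_set.
pose u t n := (\int[mu]_(s in `[0%R, t])
  (power_kernel mu l n beta p t s * v s `^ p)) `^ p^-1.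
have pow_restr (f : R -> \bar R) s : ((fun r => f r `^ p) \_ I) s =
  (f \_ I) s `^ p.
  by rewrite !patchE; case: ifP => // _; rewrite poweR0r// gt_eqF.
have uE t n : I t -> u t n.+1 = (\int[mu]_s
    (trace_kernel mu K `[0%R, t] p beta n s * (v \_ I) s `^ p)) `^ p^-1.
  move=> It; rewrite /u (integral_power_kernel hI)//; congr (_ `^ _).
  by apply: eq_integral => s _; rewrite pow_restr.
have u_ge0 t n : 0 <= u t n by exact: poweR_ge0.
have upper t : J t -> (\int[mu]_(s in `[0%R, t]) moment P p X s) `^ p^-1 <=
    (\int[mu]_(s in `[0%R, t]) (v s `^ p)) `^ p^-1 + \sum_(1 <= n <oo) u t n.
  move=> Jt; have It := JI _ Jt.
  (* The remainder after n terms is the power 1/p of the sequence in [hlim] at index n+1. *)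
  apply: (le_series_of_partial _ _ _ _ (hlim t Jt) (r := p^-1%R)) => //.
  - by rewrite invr_gt0.
  - exact: poweR_ge0.
  - move=> n; rewrite (integral_power_kernel hI)//; apply: integral_ge0 => s _.
    by rewrite mule_ge0 ?trace_kernel_ge0//; apply: restr_ge0 => r;
      exact: moment_ge0.
  - move=> n; rewrite momentE// vE//.
    under eq_bigr do rewrite uE//.
    rewrite (integral_power_kernel hI)//.
    have := @norm_iteration_bound _ _ _ mu K `[0%R, t] p beta hK
      (measurable_itv _) beta1 betap n _ x x0 mv (mroot _ hX) (mroot _ hX0)
      v'_ge0 (root_ge0 _) (root_ge0 _) x0x xv.
    congr (_ <= _ + _ `^ _); apply: eq_integral => s _.
    congr (_ * _); rewrite patchE; case: ifP => [|sI].
      by rewrite inE => Is; rewrite rootX.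
    by rewrite /x0 /root patchE sI poweR0r// gt_eqF.
split => // betaE pE X0X h1' t Jt; have It := JI _ Jt.
(* Only the lower bound is left, and it is enough to prove it for each partial sum. *)
apply/eqP; rewrite eq_le upper//=;
  apply: (ge_series_of_partial (u := u t)) => //.
  exact: poweR_ge0.
(* All exponents are now 1; first powers are the identity on nonnegative values, hence the side
   conditions. *)
have powp y : 0 <= y -> y `^ p = y by rewrite pE; exact: poweRe1.
have powVp y : 0 <= y -> y `^ p^-1 = y by rewrite pE invr1; exact: poweRe1.
have powb y : 0 <= y -> y `^ beta = y by rewrite betaE; exact: poweRe1.
have powVb y : 0 <= y -> y `^ beta^-1 = y by rewrite betaE invr1;
  exact: poweRe1.
have mx := mroot _ hX; have mx0 := mroot _ hX0.
have xx0 : {ae mu, forall s, x s <= x0 s}.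
  apply: ae_of_J => s; rewrite /x0 /x /root !patchE; first by move=> nI;
    rewrite !memNset.
  by move=> Js; rewrite mem_set ?X0X//; exact: JI.
(* On [J], equality in (1) reads x = v + K x0 with the linear operator of [K], and x <= x0 almost
   everywhere gives K x <= K x0. Off [I] both sides are 0. *)
have vKx : {ae mu, forall s, (v \_ I) s + kernel_op mu K x s <= x s}.
  apply: ae_of_J => s.
    move=> nI; rewrite /x /root !patchE !memNset// add0e le_eqVlt.
    apply/orP; left; apply/eqP/integral0_eq => r _.
    by rewrite /K triangle_kernel0 ?mul0e// => -[].
  move=> Js; have Is := JI _ Js.
  rewrite [leRHS]/x /root !patchE mem_set// h1'// opE// leeD2l//.
  rewrite /root_op powVb; last by apply: kernel_op_ge0 => // r;
    exact: poweR_ge0.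
  have -> : (fun r => x0 r `^ beta) = x0.
    by apply/funext => r; rewrite powb//; exact: root_ge0.
  by apply: le_kernel_op => //; exact: root_ge0.
move=> n; have := @integral_iteration_lower _ _ _ mu K `[0%R, t] n _ x hK
  (measurable_itv _) mv mx v'_ge0 (root_ge0 _) vKx.
rewrite momentE// vE// -/x !powVp.
- congr (_ + _ <= _).
  + by apply: eq_integral => s _; rewrite powp.
  + apply: eq_bigr => i _; rewrite uE// powVp.
      by apply: eq_integral => s _; rewrite powp// pE betaE.
    by apply: integral_ge0 => s _;
      rewrite mule_ge0 ?poweR_ge0 ?trace_kernel_ge0.
  + by apply: eq_integral => s _; rewrite powp//; exact: root_ge0.
- by apply: integral_ge0 => s _; exact: poweR_ge0.
- by apply: integral_ge0 => s _; exact: poweR_ge0.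
Qed.
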